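(* Consider the concentric nanoshell with $\epsilon_1=\epsilon_3=\epsilon_5$ and $\epsilon_s:=\epsilon_2=\epsilon_4$, where $\epsilon_s=\epsilon_s(\omega)$ obeys the Drude model. Suppose the angular frequency $\omega$ of the incident light is chosen such that $$\lim_{\tau\to0}\epsilon_s(\omega)=\epsilon^*(\omega)$$ and there exists a vector $v_1^*\in\mathbb{R}^4$ such that $$P(\epsilon^* )\,v_1^*=0,\qquad |v_1^*|=1,\qquad v_1^*\cdot e\neq0 ,$$ where $e=(1,-1,1,-1)^T$. Then plasmon resonance happens in the concentric nanoshell, i.e. the energy $\mathcal{E}$ (depending on $\tau>0$) generated in the metal shells satisfies $$\lim_{\tau\to0}\tau\,\mathcal{E}=\infty .$$
   Context: Setting: let $0<r_1<r_2<r_3<r_4$ and, with $r=|\mathbf{x}|$, $\mathbf{x}\in\mathbb{R}^3$, put $$A_1=\{r\le r_1\},\quad A_j=\{r_{j-1}<r\le r_j\}\ (j=2,3,4),\quad A_5=\{r>r_4\}.$$ The region $A_j$ has permittivity $\epsilon_j$. Regions $A_1,A_3$ are dielectric, $A_2,A_4$ are the metal shells, and $A_5$ is the embedding medium. It is assumed that $\epsilon_1=\epsilon_3=\epsilon_5>0$ is a fixed real constant and $\epsilon_2=\epsilon_4=\epsilon_s$, where $\epsilon_s$ follows the Drude model $$\epsilon_s=\epsilon_s(\omega)=\epsilon_0\Big(1-\frac{\omega_p^2}{\omega(\omega+i\tau)}\Big),$$ with constant $\epsilon_0>0$, plasma frequency $\omega_p>0$, angular frequency $\omega>0$ and resonance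 width $\tau>0$. The incident field is a uniform field $\mathbf{E}_0\ne0$ (a constant vector independent of $\tau$). Let $Y_1^m$, $m=-1,0,1$, be the (orthonormal) spherical harmonics of degree $1$ and write $\mathbf{E}_0\cdot\mathbf{x}=r\sum_{m=-1}^1a_{0m}Y_1^m$. The total electric potential is taken to be of the form $$u=\begin{cases} r\sum_{m=-1}^1a_{1m}Y_1^m, & \mathbf{x}\in A_1,\\ r\sum_{m=-1}^1a_{jm}Y_1^m+r^{-2}\sum_{m=-1}^1b_{jm}Y_1^m, & \mathbf{x}\in A_j,\ j=2,3,4,\\ r\sum_{m=-1}^1a_{0m}Y_1^m+r^{-2}\sum_{m=-1}^1b_{5m}Y_1^m, & \mathbf{x}\in A_5,\end{cases}$$ where, with $b_{1m}=0$ and $a_{5m}=a_{0m}$, the coefficients are determined by the transmission conditions, for $j=1,2,3,4$ and $m=-1,0,1$, $$a_{j+1,m}r_j+b_{j+1,m}r_j^{-2}=a_{jm}r_j+b_{jm}r_j^{-2},$$ $$\epsilon_{j+1}\big(a_{j+1,m}-2b_{j+1,m}r_j^{-3}\big)=\epsilon_j\big(a_{jm}-2b_{jm}r_j^{-3}\big).$$ Set $\lambda_j=\dfrac{2\epsilon_{j+1}+\epsilon_j}{\epsilon_{j+1}-\epsilon_j}$, $j=1,2,3,4$, and $$P=\begin{bmatrix}\lambda_1&-1&-1&-1\\-2(r_1/r_2)^3&-\lambda_2&1&1\\2(r_1/r_3)^3&2(r_2/r_3)^3&\lambda_3&-1\\-2(r_1/r_4)^3&-2(r_2/r_4)^3&-2(r_3/r_4)^3&-\lambda_4\end{bmatrix}.$$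 Since $\epsilon_1=\epsilon_3=\epsilon_5$ and $\epsilon_2=\epsilon_4=\epsilon_s$, one has $\lambda_1=\lambda_3=1-\lambda_2=1-\lambda_4=\dfrac{2\epsilon_s+\epsilon_1}{\epsilon_s-\epsilon_1}$, so $P$ is a function of $\epsilon_s$ (with the radii and $\epsilon_1$ fixed), written $P(\epsilon_s)$. $P(\epsilon^* )$ denotes its value at $\epsilon_s=\epsilon^*$ (it is understood that $\epsilon^*\ne\epsilon_1$, so that $P(\epsilon^* )$ is defined). The energy generated in the metal shells is $$\mathcal{E}=\int_{A_2}\Big|\sum_{m=-1}^1\big(r\,a_{2m}Y_1^m+r^{-2}b_{2m}Y_1^m\big)\Big|^2d\mathbf{x}+\int_{A_4}\Big|\sum_{m=-1}^1\big(r\,a_{4m}Y_1^m+r^{-2}b_{4m}Y_1^m\big)\Big|^2d\mathbf{x}.$$ Definition (plasmon resonance): plasmon resonance is said to happen if $\lim_{\tau\to0}\tau\,\mathcal{E}=\infty$. *)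

(* Defs.v *)
From HB Require Import structures.
From mathcomp Require Import all_boot all_order all_algebra.
From mathcomp Require Import complex.
From mathcomp Require Import all_classical all_reals all_analysis.

Set Implicit Arguments.
Unset Strict Implicit.
Unset Printing Implicit Defensive.

Import Order.TTheory GRing.Theory Num.Theory.
Import numFieldNormedType.Exports.

Local Open Scope classical_set_scope.
Local Open Scope ring_scope.
Local Open Scope complex_scope.

(* Bilinear: there is no conjugation, also over the complex numbers. *)
Definition vdot (K : pzRingType) (n : nat) (u v : 'cV[K]_n) : K :=
  \sum_(i < n) u i 0 * v i 0.

(* The norm that the library puts on 'cV[R]_n is the sup norm. *)
Definition vnorm (R : realType) (n : nat) (u : 'cV[R]_n) : R :=
  Num.sqrt (vdot u u).

(* Points of R^3 are iterated pairs, so that the product measure applies. *)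
Definition vec3 (R : realType) (x : R * R * R) : 'cV[R]_3 :=
  \col_(i < 3) [:: x.1.1; x.1.2; x.2]`_i.

Definition rad (R : realType) (x : R * R * R) : R := vnorm (vec3 x).

Definition lebesgue3 (R : realType) :=
  (@lebesgue_measure R \x @lebesgue_measure R \x @lebesgue_measure R)%E.

(* The index m : 'I_3 stands for the order m - 1 in {-1, 0, 1}; the
   Condon-Shortley phase is used.  At the origin Y1 m x = 0. *)
Definition Y1 (R : realType) (m : 'I_3) (x : R * R * R) : R[i] :=
  let s := Num.sqrt (3 / (8 * pi)) / rad x in
  match val m with
  | 0%N => (s * x.1.1) -i* (s * x.1.2)
  | 1%N => (Num.sqrt (3 / (4 * pi)) / rad x * x.2)%:C
  | _ => - ((s * x.1.1) +i* (s * x.1.2))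
  end.

Definition drude (R : realType) (eps0 omegap omega tau : R) : R[i] :=
  eps0%:C * (1 - (omegap ^+ 2)%:C / (omega%:C * (omega +i* tau))).

(* Regions, interfaces and permittivities are numbered from 1. *)
Definition permittivity (R : realType) (eps1 : R) (epss : R[i]) (j : nat)
  : R[i] := if odd j then eps1%:C else epss.

Definition lam (R : realType) (eps : nat -> R[i]) (j : nat) : R[i] :=
  (2 * eps j.+1 + eps j) / (eps j.+1 - eps j).

Definition Pmx (R : realType) (r : nat -> R) (eps : nat -> R[i])
  : 'M[R[i]]_4 :=
  let l := lam eps in
  let q i j := ((r i / r j) ^+ 3)%:C in
  \matrix_(i < 4, j < 4)
    (nth [::]
      [:: [:: l 1%N;            -1;                -1;                -1    ];
          [:: -2 * q 1%N 2%N;   - l 2%N;           1;                 1     ];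
          [:: 2 * q 1%N 3%N;    2 * q 2%N 3%N;     l 3%N;             -1    ];
          [:: -2 * q 1%N 4%N;   -2 * q 2%N 4%N;    -2 * q 3%N 4%N;    - l 4%N]]
      i)`_j.

Definition evec (R : realType) : 'cV[R]_4 := \col_(i < 4) [:: 1; -1; 1; -1]`_i.

Definition incident (R : realType) (E0 : 'cV[R[i]]_3) (a0 : 'I_3 -> R[i])
  : Prop :=
  forall x : R * R * R,
    vdot E0 (map_mx (real_complex R) (vec3 x))
    = (rad x)%:C * \sum_(m < 3) a0 m * Y1 m x.

Definition transmission (R : realType) (r : nat -> R) (eps : nat -> R[i])
    (a0 : 'I_3 -> R[i]) (a b : nat -> 'I_3 -> R[i]) : Prop :=
  forall m : 'I_3,
    [/\ b 1%N m = 0,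
        a 5%N m = a0 m
      & forall j : nat, (1 <= j <= 4)%N ->
          a j.+1 m * (r j)%:C + b j.+1 m * (r j ^- 2)%:C
            = a j m * (r j)%:C + b j m * (r j ^- 2)%:C
          /\ eps j.+1 * (a j.+1 m - 2 * b j.+1 m * (r j ^- 3)%:C)
            = eps j * (a j m - 2 * b j m * (r j ^- 3)%:C)].

Definition potential (R : realType) (a b : nat -> 'I_3 -> R[i]) (j : nat)
    (x : R * R * R) : R[i] :=
  \sum_(m < 3) ((rad x)%:C * a j m * Y1 m x
                + (rad x ^- 2)%:C * b j m * Y1 m x).

Definition shell (R : realType) (r : nat -> R) (j : nat) : set (R * R * R) :=
  [set x | r j.-1 < rad x <= r j].

Definition shell_energy (R : realType) (r : nat -> R)
    (a b : nat -> 'I_3 -> R[i]) : \bar R :=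
  (\int[@lebesgue3 R]_(x in shell r 2) (ComplexField.Normc.normc (potential a b 2 x) ^+ 2)%:E
   + \int[@lebesgue3 R]_(x in shell r 4) (ComplexField.Normc.normc (potential a b 4 x) ^+ 2)%:E)%E.

Definition plasmon_resonance (R : realType) (energy : R -> \bar R) : Prop :=
  (tau%:E * energy tau)%E @[tau --> 0^'+] --> +oo%E.

(* Main.v *)
Require Import Defs.
From HB Require Import structures.
From mathcomp Require Import all_boot all_order all_algebra.
From mathcomp Require Import complex.
From mathcomp Require Import all_classical all_reals all_analysis.
From mathcomp Require Import ring lra.

Set Implicit Arguments.
Unset Strict Implicit.
Unset Printing Implicit Defensive.

Import Order.TTheory GRing.Theory Num.Theory.
Import numFieldNormedType.Exports.

Local Open Scope classical_set_scope.
Local Open Scope ring_scope.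
Local Open Scope complex_scope.

(** Resonance is forced by a source-free field of the lossless limit.  A null
    vector of [P] at the limit permittivity [epsstar] lists the jumps, across the
    four interfaces, of the coefficients of a non-zero potential [w] that solves
    the transmission problem with permittivity [epsstar] and no incident field.

    Let [u] be the potential for the lossy permittivity [eps].  Green's second
    identity for [u] and [w], summed over the layers, cancels in the dielectric
    ones, where both problems have the same permittivity, and leaves
    [3 eps1 a0 beta = (eps - epsstar) B(u, w)] up to sign, where [beta] is the dipole
    moment of [w] at infinity and [B] the Dirichlet form over the two shells
    ([transmission_reciprocity]).  Moreover [beta] is not zero: a source-free
    field without dipole moment has vanishing Cauchy data on the outermost
    sphere, hence vanishes in all layers ([transmission_unique_continuation]).
    So the coefficients of [u] in the shells are at least of order
    [1 / |eps - epsstar|] ([shell_coefficients_blowup]).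

    In the Drude model [epsstar] is the value at [tau = 0], and
    [|eps - epsstar| = O(tau)] ([drude_lossless], [drude_limit]); so the
    coefficients grow at least like [1 / tau].  The energy of a shell dominates
    the square of each coefficient ([shell_potential_coercive]): degree-one
    fields are determined by their values at two points on each coordinate axis,
    and this persists with a uniform constant on small balls around these points,
    whose volume is explicit.  Hence the energy is at least of order
    [1 / tau ^ 2], and [tau] times the energy at least of order [1 / tau]. *)

(** * Reciprocity between two transmission problems *)

(** Scaled by a power of the radius, the conditions at an interface only involve
    its cube, the natural variable for degree-one fields. *)
Lemma interface_cubeP (R : realType) (s : R) (e e' a b a' b' : R[i]) :
  s != 0 ->
  (a' * s%:C + b' * (s ^- 2)%:C = a * s%:C + b * (s ^- 2)%:C
   /\ e' * (a' - 2 * b' * (s ^- 3)%:C) = e * (a - 2 * b * (s ^- 3)%:C))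
  <->
  (a' * (s ^+ 3)%:C + b' = a * (s ^+ 3)%:C + b
   /\ e' * (a' * (s ^+ 3)%:C - 2 * b') = e * (a * (s ^+ 3)%:C - 2 * b)).
Proof.
move=> s0; have z0 : s%:C != 0 :> R[i] by rewrite fmorph_eq0.
rewrite !fmorphV !rmorphXn /=; move: (s%:C) z0 => z z0.
have z2 : z ^+ 2 != 0 by rewrite expf_neq0.
have z3 : z ^+ 3 != 0 by rewrite expf_neq0.
have E1 (x y : R[i]) : x * z + y * z ^- 2 = (x * z ^+ 3 + y) / z ^+ 2 by field.
have E2 (x y w : R[i]) :
  w * (x - 2 * y * z ^- 3) = w * (x * z ^+ 3 - 2 * y) / z ^+ 3 by field.
rewrite !E1 !E2; split=> -[h1 h2]; split; first exact: (divIf z2).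
- exact: (divIf z3).
- by rewrite h1.
- by rewrite h2.
Qed.

(** The Dirichlet form, the integral of [grad u . grad u'] over layer [j], of two
    degree-one fields with a common normalised angular part.  There are no mixed
    terms because [grad (r^-2 Y)] has mean zero on spheres. *)
Definition layer_pairing (R : realType) (r : nat -> R)
    (a b a' b' : nat -> 'I_3 -> R[i]) (m : 'I_3) (j : nat) : R[i] :=
  a j m * a' j m * (r j ^+ 3 - r j.-1 ^+ 3)%:C
  + 2 * (b j m * b' j m) * (r j.-1 ^- 3 - r j ^- 3)%:C.

(** Green's second identity in one layer with cubed radii [q], [p] of the bounding
    spheres: boundary values times conormal derivatives on the left, and on the
    right the difference of the permittivities times the Dirichlet form. *)
Lemma wronskian_layer (F : fieldType) (p q e e' a b a' b' : F) :
  p != 0 -> q != 0 ->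
  ((a * p + b) * (e' * (a' * p - 2 * b'))
     - (a' * p + b') * (e * (a * p - 2 * b))) / p
  - ((a * q + b) * (e' * (a' * q - 2 * b'))
     - (a' * q + b') * (e * (a * q - 2 * b))) / q
  = (e' - e) * (a * a' * (p - q) + 2 * (b * b') * (q^-1 - p^-1)).
Proof. by move=> p0 q0; field; rewrite p0 q0. Qed.

(** The boundary terms of Green's identity match across every interface, since
    potential and flux are continuous there, so they telescope.  The layers 1
    and 3, with permittivity [eps1] in both problems, contribute nothing, and what
    remains at the outer sphere couples the dipole moment of each field to the
    incident amplitude of the other. *)
Lemma transmission_reciprocity (R : realType) (r : nat -> R) (eps1 : R)
    (eps eps' : R[i]) (a0 a0' : 'I_3 -> R[i])
    (a b a' b' : nat -> 'I_3 -> R[i]) (m : 'I_3) :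
  (forall j, (1 <= j <= 4)%N -> 0 < r j) ->
  transmission r (permittivity eps1 eps) a0 a b ->
  transmission r (permittivity eps1 eps') a0' a' b' ->
  3 * eps1%:C * (b 5%N m * a0' m - a0 m * b' 5%N m)
  = (eps' - eps) * (layer_pairing r a b a' b' m 2%N
                    + layer_pairing r a b a' b' m 4%N).
Proof.
move=> rpos /(_ m)[b1 a5 T] /(_ m)[b1' a5' T'].
have p0 j : (1 <= j <= 4)%N -> (r j ^+ 3)%:C != 0 :> R[i].
  by move=> /rpos rj; rewrite fmorph_eq0 expf_neq0 ?gt_eqF.
have C j (jP : (1 <= j <= 4)%N) :=
  (interface_cubeP _ _ _ _ _ _ (lt0r_neq0 (rpos j jP))).1 (T j jP).
have C' j (jP : (1 <= j <= 4)%N) :=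
  (interface_cubeP _ _ _ _ _ _ (lt0r_neq0 (rpos j jP))).1 (T' j jP).
have [C1 D1] := C 1%N isT; have [C2 D2] := C 2%N isT.
have [C3 D3] := C 3%N isT; have [C4 D4] := C 4%N isT.
have [C1' D1'] := C' 1%N isT; have [C2' D2'] := C' 2%N isT.
have [C3' D3'] := C' 3%N isT; have [C4' D4'] := C' 4%N isT.
move: (p0 1%N isT) (p0 2%N isT) (p0 3%N isT) (p0 4%N isT) => p1 p2 p3 p4.
rewrite /permittivity /= in D1 D2 D3 D4 D1' D2' D3' D4'.
have W2 := wronskian_layer eps eps' (a 2%N m) (b 2%N m) (a' 2%N m) (b' 2%N m) p2 p1.
have W3 := wronskian_layer eps1%:C eps1%:C (a 3%N m) (b 3%N m)
  (a' 3%N m) (b' 3%N m) p3 p2.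
have W4 := wronskian_layer eps eps' (a 4%N m) (b 4%N m) (a' 4%N m) (b' 4%N m) p4 p3.
rewrite C1 D1 C1' D1' b1 b1' in W2.
rewrite C2 D2 C2' D2' subrr mul0r in W3.
rewrite C3 D3 C3' D3' in W4.
(* Outside the last sphere both fields see [eps1], so the boundary term is the
   constant Wronskian of [r] and [r^-2]. *)
have W5 : 3 * eps1%:C * (b 5%N m * a0' m - a0 m * b' 5%N m) =
  ((a 4%N m * (r 4%N ^+ 3)%:C + b 4%N m)
      * (eps' * (a' 4%N m * (r 4%N ^+ 3)%:C - 2 * b' 4%N m))
    - (a' 4%N m * (r 4%N ^+ 3)%:C + b' 4%N m)
      * (eps * (a 4%N m * (r 4%N ^+ 3)%:C - 2 * b 4%N m)))
   / (r 4%N ^+ 3)%:C.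
  by rewrite -C4 -D4 -C4' -D4' a5 a5' /=; move: (r 4%N ^+ 3)%:C p4 => z z0; field.
have L j : layer_pairing r a b a' b' m j =
    a j m * a' j m * ((r j ^+ 3)%:C - (r j.-1 ^+ 3)%:C)
    + 2 * (b j m * b' j m) * ((r j.-1 ^+ 3)%:C^-1 - (r j ^+ 3)%:C^-1).
  by rewrite /layer_pairing !rmorphB !fmorphV.
(* The vanishing boundary term of the third layer bridges the two shells. *)
rewrite W5 (L 2%N) (L 4%N) /= [RHS]mulrDr -W4 -W2 -[LHS]subr0.
rewrite -[X in _ - X = _]W3.
move: (r 1%N ^+ 3)%:C (r 2%N ^+ 3)%:C (r 3%N ^+ 3)%:C
  (r 4%N ^+ 3)%:C p1 p2 p3 p4 => z1 z2 z3 z4 p1 p2 p3 p4; field.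
by rewrite p1 p2 p3 p4.
Qed.

(** * Source-free fields *)

(** Without incident amplitude and dipole moment the field vanishes outside the
    last sphere, so its Cauchy data vanish there and it is zero in all layers
    inwards.  The degenerate permittivity [eps = 0] does not transmit flux; the
    dielectric layers then carry no flux at all, which kills the field in them,
    and a field vanishing on both boundary spheres of a shell is zero. *)
Lemma transmission_unique_continuation (R : realType) (r : nat -> R)
    (eps1 : R) (eps : R[i]) (a0 : 'I_3 -> R[i]) (a b : nat -> 'I_3 -> R[i])
    (m : 'I_3) :
  0 < r 1%N -> r 1%N < r 2%N -> r 2%N < r 3%N -> r 3%N < r 4%N ->
  eps1 != 0 ->
  transmission r (permittivity eps1 eps) a0 a b ->
  a0 m = 0 -> b 5%N m = 0 ->
  forall j, (1 <= j <= 5)%N -> a j m = 0.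
Proof.
move=> r1 r12 r23 r34 e10 /(_ m)[b1 a5 T] a00 b50.
have r2 := lt_trans r1 r12; have r3 := lt_trans r2 r23.
have r4 := lt_trans r3 r34.
have [C1 D1] := (interface_cubeP _ _ _ _ _ _ (lt0r_neq0 r1)).1 (T 1%N isT).
have [C2 D2] := (interface_cubeP _ _ _ _ _ _ (lt0r_neq0 r2)).1 (T 2%N isT).
have [C3 D3] := (interface_cubeP _ _ _ _ _ _ (lt0r_neq0 r3)).1 (T 3%N isT).
have [C4 D4] := (interface_cubeP _ _ _ _ _ _ (lt0r_neq0 r4)).1 (T 4%N isT).
have cube0 (s : R) : 0 < s -> (s ^+ 3)%:C != 0 :> R[i].
  by move=> s0; rewrite fmorph_eq0 expf_neq0 ?gt_eqF.
have cube_lt (s t : R) : 0 < s -> s < t ->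
    (t ^+ 3)%:C - (s ^+ 3)%:C != 0 :> R[i].
  move=> s0 st; rewrite -rmorphB fmorph_eq0 subr_eq0 gt_eqF//.
  by rewrite ltrXn2r// ?ltW// (lt_trans s0).
have three0 : 3 != 0 :> R[i] by rewrite pnatr_eq0.
have e1C : eps1%:C != 0 :> R[i] by rewrite fmorph_eq0.
rewrite /permittivity/= a5 a00 b50 b1 in C1 D1 C2 D2 C3 D3 C4 D4.
move: (cube0 _ r1) (cube0 _ r2) (cube0 _ r3) (cube0 _ r4)
  (cube_lt _ _ r1 r12) (cube_lt _ _ r2 r23) (cube_lt _ _ r3 r34).
move: (r 1%N ^+ 3)%:C (r 2%N ^+ 3)%:C (r 3%N ^+ 3)%:C (r 4%N ^+ 3)%:C
  C1 D1 C2 D2 C3 D3 C4 D4 => p1 p2 p3 p4 C1 D1 C2 D2 C3 D3 C4 D4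
  p10 p20 p30 p40 p12 p23 p34.
move: (eps1%:C) e1C D1 D2 D3 D4 => e1 e1C D1 D2 D3 D4.
(* A field vanishing on both sides of an interface, together with its flux,
   vanishes in the next layer inwards provided the latter conducts flux. *)
have inward (e p x y : R[i]) : e != 0 -> p != 0 ->
    0 = x * p + y -> 0 = e * (x * p - 2 * y) -> x = 0 /\ y = 0.
  move=> e0 q0 h1 /esym/eqP; rewrite mulf_eq0 (negbTE e0) => /eqP h2.
  have x0 : x = 0.
    apply: (mulIf (mulf_neq0 three0 q0)); rewrite mul0r.
    by transitivity (2 * (x * p + y) + (x * p - 2 * y));
      [ring|rewrite -h1 h2; ring].
  by split=> //; move: h1; rewrite x0; move=> ->; ring.
have [eps0|eps_neq0] := eqVneq eps 0.
  have flux (p x y : R[i]) : e1 * (x * p - 2 * y) = 0 -> x * p = 2 * y.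
    by move=> /eqP; rewrite mulf_eq0 (negbTE e1C) => /eqP/subr0_eq.
  have [a1 a3] : a 1%N m = 0 /\ a 3%N m = 0.
    split.
      have /flux : e1 * (a 1%N m * p1 - 2 * 0) = 0 by rewrite -D1 eps0; ring.
      by rewrite mulr0 => /eqP; rewrite mulf_eq0 (negbTE p10) orbF => /eqP.
    have /flux h2 : e1 * (a 3%N m * p2 - 2 * b 3%N m) = 0 by rewrite D2 eps0; ring.
    have /flux h3 : e1 * (a 3%N m * p3 - 2 * b 3%N m) = 0 by rewrite -D3 eps0; ring.
    by apply: (mulIf p23); rewrite mulrBr h2 h3; ring.
  have b3 : b 3%N m = 0.
    have /flux : e1 * (a 3%N m * p2 - 2 * b 3%N m) = 0 by rewrite D2 eps0; ring.
    rewrite a3 mul0r => /esym/eqP; rewrite mulf_eq0 pnatr_eq0/=.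
    by move/eqP.
  have two (p q x y : R[i]) : q - p != 0 ->
    x * p + y = 0 -> x * q + y = 0 -> x = 0.
    move=> pq h1 h2; apply: (mulIf pq); rewrite mul0r.
    by transitivity ((x * q + y) - (x * p + y)); [ring|rewrite h1 h2; ring].
  have a2 : a 2%N m = 0.
    apply: (two _ _ _ (b 2%N m) p12); first by rewrite C1 a1; ring.
    by rewrite -C2 a3 b3; ring.
  have a4 : a 4%N m = 0.
    apply: (two _ _ _ (b 4%N m) p34); first by rewrite C3 a3 b3; ring.
    by rewrite -C4; ring.
  by case=> [|[|[|[|[|[|]]]]]] // _; rewrite a5.
have [a4 b4] : a 4%N m = 0 /\ b 4%N m = 0.
  by apply: (inward eps p4) => //; [rewrite -C4|rewrite -D4]; ring.
have [a3 b3] : a 3%N m = 0 /\ b 3%N m = 0.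
  by apply: (inward e1 p3) => //; [rewrite -C3|rewrite -D3]; rewrite a4 b4; ring.
have [a2 b2] : a 2%N m = 0 /\ b 2%N m = 0.
  by apply: (inward eps p2) => //; [rewrite -C2|rewrite -D2]; rewrite a3 b3; ring.
have [a1 _] : a 1%N m = 0 /\ 0 = 0 :> R[i].
  by apply: (inward e1 p1) => //; [rewrite -C1|rewrite -D1]; rewrite a2 b2; ring.
by case=> [|[|[|[|[|[|]]]]]] // _; rewrite a5.
Qed.

(** * Null vectors of [P] as source-free fields *)

(** [v k] is the drop of the coefficient of [r] across the sphere [k.+1], which by
    continuity raises the coefficient of [r^-2] by [r k.+1 ^+ 3 * v k].  The
    coefficients in layer [j] follow by summing from outside for the former, where
    the incident amplitude is zero, and from the centre for the latter. *)
Definition jump_a (K : pzRingType) (v : 'cV[K]_4) (j : nat) : K :=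
  \sum_(k < 4 | (j <= k.+1)%N) v k 0.

Definition jump_b (R : realType) (r : nat -> R) (v : 'cV[R[i]]_4) (j : nat)
    : R[i] :=
  \sum_(k < 4 | (k.+1 < j)%N) (r k.+1 ^+ 3)%:C * v k 0.

Lemma jump_aE (K : pzRingType) (v : 'cV[K]_4) (j : nat) :
  jump_a v j = (if (j <= 1)%N then v 0 0 else 0)
    + (if (j <= 2)%N then v 1 0 else 0)
    + (if (j <= 3)%N then v 2%:R 0 else 0)
    + (if (j <= 4)%N then v 3%:R 0 else 0).
Proof.
rewrite /jump_a big_mkcond !big_ord_recr big_ord0/= add0r.
by congr (_ + _ + _ + _); congr (if _ then v _ _ else _); apply/val_inj.
Qed.

Lemma jump_bE (R : realType) (r : nat -> R) (v : 'cV[R[i]]_4) (j : nat) :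
  jump_b r v j = (if (1 < j)%N then (r 1%N ^+ 3)%:C * v 0 0 else 0)
    + (if (2 < j)%N then (r 2%N ^+ 3)%:C * v 1 0 else 0)
    + (if (3 < j)%N then (r 3%N ^+ 3)%:C * v 2%:R 0 else 0)
    + (if (4 < j)%N then (r 4%N ^+ 3)%:C * v 3%:R 0 else 0).
Proof.
rewrite /jump_b big_mkcond !big_ord_recr big_ord0/= add0r.
by congr (_ + _ + _ + _); congr (if _ then _ * v _ _ else _); apply/val_inj.
Qed.

(** A row of [P], here divided by its sign and with [A], [B] collecting the jumps
    outside and inside the sphere of cubed radius [p], is the flux condition at
    that sphere. *)
Lemma flux_of_row (F : fieldType) (p e e' x A B : F) :
  p != 0 -> e' - e != 0 ->
  (2 * e' + e) / (e' - e) * x = A - 2 * (B / p) ->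
  e' * (A * p - 2 * (B + p * x)) = e * ((A + x) * p - 2 * B).
Proof.
move=> p0 d0 h; apply: subr0_eq.
transitivity ((e' - e) * p * (A - 2 * (B / p) - (2 * e' + e) / (e' - e) * x)).
  by field; rewrite ?p0 ?d0.
by rewrite h subrr mulr0.
Qed.

(** Continuity holds by the construction from jumps, and the rows of [P] are the
    four flux conditions; [eps != eps1] makes the contrasts [lam] meaningful. *)
Lemma kernel_transmission (R : realType) (r : nat -> R) (eps1 : R)
    (eps : R[i]) (v : 'cV[R[i]]_4) :
  (forall j, (1 <= j <= 4)%N -> 0 < r j) -> eps != eps1%:C ->
  Pmx r (permittivity eps1 eps) *m v = 0 ->
  transmission r (permittivity eps1 eps) (fun=> 0)
    (fun j _ => jump_a v j) (fun j _ => jump_b r v j).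
Proof.
move=> rpos neq Pv m.
have p0 j : (1 <= j <= 4)%N -> (r j ^+ 3)%:C != 0 :> R[i].
  by move=> /rpos rj; rewrite fmorph_eq0 expf_neq0 ?gt_eqF.
have q i j : ((r i / r j) ^+ 3)%:C = (r i ^+ 3)%:C / (r j ^+ 3)%:C :> R[i].
  by rewrite expr_div_n rmorphM fmorphV.
move: (p0 1%N isT) (p0 2%N isT) (p0 3%N isT) (p0 4%N isT) => p1 p2 p3 p4.
have d1 : eps - eps1%:C != 0 by rewrite subr_eq0.
have d2 : eps1%:C - eps != 0 by rewrite subr_eq0 eq_sym.
split.
- by rewrite /jump_b big_pred0.
- by rewrite /jump_a big_pred0// => k; rewrite ltnNge ltnS -ltnS ltn_ord.
move=> j jP; apply/(interface_cubeP _ _ _ _ _ _ (lt0r_neq0 (rpos j jP))).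
have row i := congr1 (fun w : 'cV_4 => w i 0) Pv.
move: (row 0) (row 1) (row 2%:R) (row 3%:R) => {row}.
rewrite !mxE !big_ord_recr !big_ord0/= !mxE/= !q /lam /permittivity.
rewrite !jump_aE !jump_bE.
have -> : widen_ord (leqnSn 3) (widen_ord (leqnSn 2) (widen_ord (leqnSn 1) ord_max))
    = 0 by apply/val_inj.
have -> : widen_ord (leqnSn 3) (widen_ord (leqnSn 2) ord_max) = 1 by apply/val_inj.
have -> : widen_ord (leqnSn 3) ord_max = 2%:R by apply/val_inj.
have -> : ord_max = 3%:R :> 'I_4 by apply/val_inj.
move: (v 0 0) (v 1 0) (v 2%:R 0) (v 3%:R 0) => x1 x2 x3 x4.
case: j jP => [|[|[|[|[|]]]]]//= _;
move: (r 1%N ^+ 3)%:C (r 2%N ^+ 3)%:C (r 3%N ^+ 3)%:C (r 4%N ^+ 3)%:C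
  p1 p2 p3 p4 => p1 p2 p3 p4 p10 p20 p30 p40 R1 R2 R3 R4;
(split; first by ring).
- have /(flux_of_row p10 d1) h : (2 * eps + eps1%:C) / (eps - eps1%:C) * x1
      = x2 + x3 + x4 - 2 * (0 / p1).
    by apply: subr0_eq; rewrite -[RHS]R1; ring.
  transitivity (eps * ((x2 + x3 + x4) * p1 - 2 * (0 + p1 * x1))); first by ring.
  by rewrite h; ring.
- have /(flux_of_row p20 d2) h : (2 * eps1%:C + eps) / (eps1%:C - eps) * x2
      = x3 + x4 - 2 * (p1 * x1 / p2).
    by apply: subr0_eq; rewrite -[RHS]oppr0 -[X in _ = - X]R2; ring.
  transitivity (eps1%:C * ((x3 + x4) * p2 - 2 * (p1 * x1 + p2 * x2))).
    by ring.
  by rewrite h; ring.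
- have /(flux_of_row p30 d1) h : (2 * eps + eps1%:C) / (eps - eps1%:C) * x3
      = x4 - 2 * ((p1 * x1 + p2 * x2) / p3).
    by apply: subr0_eq; rewrite -[RHS]R3; ring.
  transitivity (eps * (x4 * p3 - 2 * (p1 * x1 + p2 * x2 + p3 * x3))).
    by ring.
  by rewrite h; ring.
- have /(flux_of_row p40 d2) h : (2 * eps1%:C + eps) / (eps1%:C - eps) * x4
      = 0 - 2 * ((p1 * x1 + p2 * x2 + p3 * x3) / p4).
    by apply: subr0_eq; rewrite -[RHS]oppr0 -[X in _ = - X]R4; ring.
  transitivity (eps1%:C * (0 * p4 - 2 * (p1 * x1 + p2 * x2 + p3 * x3 + p4 * x4))).
    by ring.
  by rewrite h; ring.
Qed.

Lemma jump_a_eq0 (K : pzRingType) (v : 'cV[K]_4) :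
  (forall j, (1 <= j <= 5)%N -> jump_a v j = 0) -> v = 0.
Proof.
move=> h; apply/matrixP => k i; rewrite ord1 mxE.
have h1 : jump_a v k.+1 = 0.
  by apply: h; exact: leqW (ltn_ord k).
have h2 : jump_a v k.+2 = 0 by apply: h; exact: (ltn_ord k).
move: h1; rewrite /jump_a (bigD1 k)//= (eq_bigl (fun l : 'I_4 => (k.+2 <= l.+1)%N)).
  by rewrite -/(jump_a v k.+2) h2 addr0.
by move=> l; rewrite !ltnS [in RHS]ltn_neqAle eq_sym andbC.
Qed.

(** * Lower bounds for integrals over R^3 *)

Section integral_lower_bound.
Import HBNNSimple.

(** The integral of a nonnegative function is a supremum over simple functions
    below it, one of which is [c] times the indicator of [Q]. *)
Lemma integral_ge_cst_subset d (T : measurableType d) (R : realType)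
    (mu : {measure set T -> \bar R}) (D Q : set T) (f : T -> R) (c : R) :
  measurable Q -> Q `<=` D -> 0 <= c -> (forall x, D x -> 0 <= f x) ->
  (forall x, Q x -> c <= f x) ->
  (c%:E * mu Q <= \int[mu]_(x in D) (f x)%:E)%E.
Proof.
move=> mQ QD c0 f0 cf; rewrite ge0_integralE; last first.
  by move=> x Dx; rewrite lee_fin f0.
apply: ereal_sup_ubound; exists (scale_nnsfun (indic_nnsfun R mQ) c0) => [|].
  move=> x; have -> : scale_nnsfun (indic_nnsfun R mQ) c0 x = c * (x \in Q)%:R.
    by [].
  rewrite /patch.
  have [xQ|xQ] := boolP (x \in Q); last first.
    by rewrite mulr0; case: ifPn => // /set_mem Dx; rewrite lee_fin f0.
  move/set_mem in xQ; rewrite mulr1 ifT ?lee_fin ?cf//.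
  by apply/mem_set/QD.
by rewrite -sintegral_indic -(@sintegralrM _ _ _ mu c (indic_nnsfun R mQ)).
Qed.

End integral_lower_bound.

Lemma lebesgue3_ball (R : realType) (p : R * R * R) (d : R) : 0 <= d ->
  measurable (ball p d) /\
  @lebesgue3 R (ball p d) = ((d *+ 2) ^+ 3)%:E.
Proof.
move=> d0; have -> : ball p d = (ball p.1.1 d `*` ball p.1.2 d) `*` ball p.2 d.
  by apply/seteqP; split=> y /=; [case=> -[]|case=> -[]].
have mb (x : R) : measurable (ball x d) by rewrite ball_itv; exact: measurable_itv.
have mX : measurable (ball p.1.1 d `*` ball p.1.2 d) by exact: measurableX (mb _) (mb _).
split; first exact: measurableX mX (mb _).
rewrite /lebesgue3.
transitivity ((@lebesgue_measure R \x @lebesgue_measure R)%E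
    (ball p.1.1 d `*` ball p.1.2 d) * @lebesgue_measure R (ball p.2 d))%E.
  rewrite product_measure1E; [by []|exact: mX|exact: mb].
transitivity (@lebesgue_measure R (ball p.1.1 d) * @lebesgue_measure R (ball p.1.2 d)
    * @lebesgue_measure R (ball p.2 d))%E.
  congr (_ * _)%E; rewrite product_measure1E; [by []|exact: mb|exact: mb].
by rewrite !lebesgue_measure_ball// -!EFinM !exprS mulr1 mulrA.
Qed.

Lemma radE (R : realType) (x : R * R * R) :
  Defs.rad x = Num.sqrt (x.1.1 ^+ 2 + x.1.2 ^+ 2 + x.2 ^+ 2).
Proof.
rewrite /Defs.rad /vnorm /vdot !big_ord_recr big_ord0/= add0r !mxE/=.
by rewrite -!expr2.
Qed.

(** A radius or constant chosen for each of finitely many cases can be replaced by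
    the least one. *)
Lemma uniform_pos (R : realType) (I : finType) (P : I -> R -> Prop) :
  (forall i (c c' : R), 0 < c' -> c' <= c -> P i c -> P i c') ->
  (forall i, exists2 c : R, 0 < c & P i c) ->
  exists2 c : R, 0 < c & forall i, P i c.
Proof.
move=> mono h0; have h i := cid2 (h0 i).
pose f i := s2val (h i).
have f0 i : 0 < f i by exact: (s2valP (h i)).
exists (\big[Order.min/1]_i f i).
  by apply: lt_bigmin => // i _; exact: f0.
move=> i; apply: (mono _ (f i)); last exact: (s2valP' (h i)).
  by apply: lt_bigmin => // j _; exact: f0.
exact: bigmin_le_cond.
Qed.

(** * Degree-one fields in Cartesian form *)

Definition axis (R : realType) (i : 'I_3) (t : R) : R * R * R :=
  (t *+ (i == 0 :> nat), t *+ (i == 1 :> nat), t *+ (i == 2 :> nat))%N.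

Lemma rad_axis (R : realType) (i : 'I_3) (t : R) : 0 < t -> Defs.rad (axis i t) = t.
Proof.
move=> t0; rewrite radE; case: i => -[|[|[|]]]//= _;
by rewrite mulr1n !mulr0n expr0n/= ?addr0 ?add0r sqrtr_sqr gtr0_norm.
Qed.

Lemma vec3_axis (R : realType) (i k : 'I_3) (t : R) :
  vec3 (axis i t) k 0 = t *+ (i == k).
Proof.
by rewrite mxE -val_eqE; case: i => -[|[|[|//]]] ?; case: k => -[|[|[|//]]] ?.
Qed.
 
Lemma rad_continuous (R : realType) : continuous (@Defs.rad R).
Proof.
move=> x; rewrite (_ : @Defs.rad R = fun x =>
    Num.sqrt (x.1.1 * x.1.1 + x.1.2 * x.1.2 + x.2 * x.2)); last first.
  by apply/funext => y; rewrite radE !expr2.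
have c1 : continuous (fun x : R * R * R => x.1.1).
  by move=> y; apply: (@cvg_comp _ _ _ fst fst); [exact: cvg_fst|exact: cvg_fst].
have c2 : continuous (fun x : R * R * R => x.1.2).
  by move=> y; apply: (@cvg_comp _ _ _ fst snd); [exact: cvg_fst|exact: cvg_snd].
have c3 : continuous (fun x : R * R * R => x.2) by move=> y; exact: cvg_snd.
apply: continuous_comp; last exact: sqrt_continuous.
by apply: cvgD; [apply: cvgD|]; apply: cvgM; (exact: c1 || exact: c2 || exact: c3).
Qed.

Lemma vec3_continuous (R : realType) (k : 'I_3) :
  continuous (fun x : R * R * R => vec3 x k 0).
Proof.
move=> x.
case: k => -[|[|[|]]]//= h.
- rewrite (_ : (fun x => _) = fun x : R * R * R => x.1.1).
    by apply: (@cvg_comp _ _ _ fst fst); [exact: cvg_fst|exact: cvg_fst].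
  by apply/funext => y; rewrite mxE.
- rewrite (_ : (fun x => _) = fun x : R * R * R => x.1.2).
    by apply: (@cvg_comp _ _ _ fst snd); [exact: cvg_fst|exact: cvg_snd].
  by apply/funext => y; rewrite mxE.
- rewrite (_ : (fun x => _) = fun x : R * R * R => x.2); first exact: cvg_snd.
  by apply/funext => y; rewrite mxE.
Qed.

(** If [sum_m a m * r * Y_1^m] is written as a linear form in the Cartesian
    coordinates, these are its coefficients. *)
Definition cart (R : realType) (a : 'I_3 -> R[i]) (i : 'I_3) : R[i] :=
  let S := (Num.sqrt (3 / (8 * pi)))%:C in
  match val i with
  | 0%N => S * (a 0 - a 2%:R)
  | 1%N => - 'i * (S * (a 0 + a 2%:R))
  | _ => (Num.sqrt (3 / (4 * pi)))%:C * a 1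
  end.

Lemma potentialE (R : realType) (a b : nat -> 'I_3 -> R[i]) (j : nat)
    (x : R * R * R) : Defs.rad x != 0 ->
  potential a b j x =
  \sum_(i < 3) (cart (a j) i + (Defs.rad x ^- 3)%:C * cart (b j) i)
               * (vec3 x i 0)%:C.
Proof.
move=> x0; have z0 : (Defs.rad x)%:C != 0 :> R[i] by rewrite fmorph_eq0.
pose S : R := Num.sqrt (3 / (8 * pi)); pose T : R := Num.sqrt (3 / (4 * pi)).
have Y10 : Y1 0 x = S%:C / (Defs.rad x)%:C * (x.1.1%:C - 'i * x.1.2%:C).
  rewrite -fmorphV -rmorphM /Y1 /= -/S.
  by apply/eqP; rewrite eq_complex /=; apply/andP; split; apply/eqP; ring.
have Y11 : Y1 1 x = T%:C / (Defs.rad x)%:C * x.2%:C.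
  by rewrite -fmorphV -!rmorphM.
have Y12 : Y1 2%:R x = - (S%:C / (Defs.rad x)%:C * (x.1.1%:C + 'i * x.1.2%:C)).
  rewrite -fmorphV -rmorphM /Y1 /= -/S.
  by apply/eqP; rewrite eq_complex /=; apply/andP; split; apply/eqP; ring.
have sum3 (F : 'I_3 -> R[i]) : \sum_(i < 3) F i = F 0 + F 1 + F 2%:R.
  rewrite !big_ord_recr big_ord0 /= add0r.
  by congr (F _ + F _ + F _); apply/val_inj.
rewrite /potential !sum3 Y10 Y11 Y12 /cart /= -/S -/T !mxE /= !fmorphV !rmorphXn /=.
by field.
Qed.
(** * Coercivity of the energy of a shell *)

Local Notation normc := ComplexField.Normc.normc.

Lemma normc_ge0 (R : realType) (z : R[i]) : 0 <= normc z.
Proof. by case: z => x y; exact: sqrtr_ge0. Qed.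

Lemma normc_real (R : realType) (x : R) : normc x%:C = `|x|.
Proof. by rewrite /= expr0n addr0 sqrtr_sqr. Qed.

Lemma normc_sum (R : realType) (I : finType) (F : I -> R[i]) :
  normc (\sum_i F i) <= \sum_i normc (F i).
Proof.
apply: (big_ind2 (fun z x => normc z <= x)) => //.
  by rewrite ComplexField.Normc.normc0.
by move=> z x w y zx wy; apply: le_trans (le_normcD _ _) _; exact: lerD.
Qed.

(** On an axis a degree-one field is [A r + B r^-2]; its values at two radii
    determine [A] and [B], the determinant being a multiple of [s^3 - t^3]. *)
Lemma two_radii (R : realType) (t s : R) : 0 < t -> t < s ->
  exists2 K : R, 0 < K & forall A B : R[i],
    normc A + normc B <=
    K * (normc (A * t%:C + B * (t ^- 2)%:C) + normc (A * s%:C + B * (s ^- 2)%:C)).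
Proof.
move=> t0 ts; have s0 := lt_trans t0 ts.
have D0 : 0 < s ^+ 3 - t ^+ 3 by rewrite subr_gt0 ltrXn2r// ltW.
set D := s ^+ 3 - t ^+ 3 in D0 *.
pose K := D^-1 * ((1 + t ^+ 3) * s ^+ 2 + (1 + s ^+ 3) * t ^+ 2).
have t2 : 0 < t ^+ 2 by rewrite exprn_gt0.
have s2 : 0 < s ^+ 2 by rewrite exprn_gt0.
have t3 : 0 < t ^+ 3 by rewrite exprn_gt0.
have s3 : 0 < s ^+ 3 by rewrite exprn_gt0.
have Di : 0 < D^-1 by rewrite invr_gt0.
exists K; first by rewrite mulr_gt0// addr_gt0// mulr_gt0// addr_gt0.
move=> A B; set X := A * t%:C + _; set Y := A * s%:C + _.
have D0C : D%:C != 0 :> R[i] by rewrite fmorph_eq0 gt_eqF.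
have t0C : t%:C != 0 :> R[i] by rewrite fmorph_eq0 gt_eqF.
have s0C : s%:C != 0 :> R[i] by rewrite fmorph_eq0 gt_eqF.
have DE : D%:C = s%:C ^+ 3 - t%:C ^+ 3 :> R[i] by rewrite rmorphB !rmorphXn.
have AE : A = (D^-1)%:C * ((s ^+ 2)%:C * Y + (- t ^+ 2)%:C * X).
  rewrite /X /Y rmorphN !fmorphV !rmorphXn /= DE; rewrite DE in D0C.
  move: (s%:C) (t%:C) D0C s0C t0C => z w h1 h2 h3.
  by field; rewrite h1 h2 h3.
have BE : B = (D^-1)%:C * ((s ^+ 3 * t ^+ 2)%:C * X + (- (t ^+ 3 * s ^+ 2))%:C * Y).
  rewrite /X /Y rmorphN !rmorphM !fmorphV !rmorphXn /= DE; rewrite DE in D0C.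
  move: (s%:C) (t%:C) D0C s0C t0C => z w h1 h2 h3.
  by field; rewrite h1 h2 h3.
have nA : normc A <= D^-1 * (s ^+ 2 * normc Y + t ^+ 2 * normc X).
  rewrite {1}AE ComplexField.Normc.normcM normc_real gtr0_norm// ler_pM2l//.
  apply: le_trans (le_normcD _ _) _.
  by rewrite !ComplexField.Normc.normcM !normc_real normrN !gtr0_norm.
have nB : normc B <= D^-1 * (s ^+ 3 * t ^+ 2 * normc X + t ^+ 3 * s ^+ 2 * normc Y).
  rewrite {1}BE ComplexField.Normc.normcM normc_real gtr0_norm// ler_pM2l//.
  apply: le_trans (le_normcD _ _) _.
  by rewrite !ComplexField.Normc.normcM !normc_real normrN !gtr0_norm ?mulr_gt0.
apply: le_trans (lerD nA nB) _; rewrite -mulrDr /K -[leRHS]mulrA ler_pM2l//.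
have := normc_ge0 X; have := normc_ge0 Y.
move: (normc X) (normc Y) => x y y0 x0.
rewrite mulrDr -subr_ge0.
rewrite [leRHS](_ : _ = ((1 + t ^+ 3) * s ^+ 2) * x + ((1 + s ^+ 3) * t ^+ 2) * y).
  by rewrite addr_ge0// mulr_ge0// mulr_ge0// ?addr_ge0// ltW.
by ring.
Qed.

(** The field is a combination of the six functions [x_k] and [x_k / r^3].  Their
    continuity at the axis point, where only two of them are non-zero, bounds the
    change of the field by [eta] times the sum of the coefficients, uniformly in
    the coefficients. *)
Lemma dipole_field_near_axis (R : realType) (lo hi t eta : R) (i : 'I_3) :
  0 < lo -> lo < t -> t < hi -> 0 < eta ->
  exists2 d : R, 0 < d & forall y : R * R * R, ball (axis i t) d y ->
    lo < Defs.rad y <= hi /\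
    forall al be : 'I_3 -> R[i],
      normc (al i * t%:C + be i * (t ^- 2)%:C)
        - eta * (\sum_k (normc (al k) + normc (be k)))
      <= normc (\sum_k (al k + (Defs.rad y ^- 3)%:C * be k) * (vec3 y k 0)%:C).
Proof.
move=> lo0 lot thi eta0; have t0 := lt_trans lo0 lot.
have rt : Defs.rad (axis i t) = t by exact: rad_axis.
have near_rad : \forall y \near axis i t, lo < Defs.rad y < hi.
  have : (fun y => Defs.rad y) @ axis i t --> t.
    by rewrite -[X in _ --> X]rt; exact: rad_continuous.
  move=> /(_ `]lo, hi[%classic); apply.
  by apply: near_in_itvoo; rewrite in_itv/= lot thi.
have near_x k : \forall y \near axis i t, `|t *+ (i == k) - vec3 y k 0| < eta.
  have : (fun y => vec3 y k 0) @ axis i t --> t *+ (i == k).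
    by rewrite -[X in _ --> X]vec3_axis; exact: vec3_continuous.
  by move/cvgrPdist_lt; apply.
have near_y k : \forall y \near axis i t,
    `|t ^- 3 * t *+ (i == k) - Defs.rad y ^- 3 * vec3 y k 0| < eta.
  have : (fun y => Defs.rad y ^- 3 * vec3 y k 0) @ axis i t
      --> t ^- 3 * (t *+ (i == k)).
    apply: cvgM; last first.
      by rewrite -[X in _ --> X]vec3_axis; exact: vec3_continuous.
    apply: cvgV; first by rewrite expf_neq0// gt_eqF.
    have cr : (fun y => Defs.rad y) @ axis i t --> t.
      by rewrite -[X in _ --> X]rt; exact: rad_continuous.
    rewrite (_ : (fun y => _) =
        (fun y => Defs.rad y * (Defs.rad y * Defs.rad y))).
      by rewrite !exprS expr0 mulr1; apply: cvgM => //; exact: cvgM.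
    by apply/funext => y; rewrite !exprS expr0 mulr1.
  by rewrite -mulrnAr; move/cvgrPdist_lt; apply.
pose close k : set (R * R * R) := [set y | `|t *+ (i == k) - vec3 y k 0| < eta /\
    `|t ^- 3 * t *+ (i == k) - Defs.rad y ^- 3 * vec3 y k 0| < eta].
have all_x : \forall y \near axis i t, forall k, close k y.
  have FF : Filter (nbhs (axis i t)) by exact: nbhs_filter.
  exact: (@filter_forall _ _ close _ FF (fun k => filterI (near_x k) (near_y k))).
have [d /= d0 dP] := (nbhs_ballP _ _).1 (filterI near_rad all_x).
exists d => // y /dP[/andP[h1 h2] h3]; split; first by rewrite h1 ltW.
move=> al be; rewrite lerBlDr.
set phi := \sum_k _.
have -> : al i * t%:C + be i * (t ^- 2)%:C = phi +
    \sum_k (al k * (t *+ (i == k) - vec3 y k 0)%:C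
      + be k * (t ^- 3 * t *+ (i == k) - Defs.rad y ^- 3 * vec3 y k 0)%:C).
  rewrite -big_split/=.
  transitivity (\sum_k (al k * (t *+ (i == k))%:C + be k * (t ^- 3 * t *+ (i == k))%:C)).
    rewrite (bigD1 i)//= eqxx !mulr1n big1 ?addr0.
      by congr (_ + _ * _%:C); field; rewrite gt_eqF.
    by move=> k /negbTE; rewrite eq_sym => ->; rewrite !mulr0n rmorph0 !mulr0 addr0.
  by apply: eq_bigr => k _; rewrite !rmorphB /= !rmorphM /=; ring.
apply: le_trans (le_normcD _ _) _; rewrite lerD2l mulr_sumr.
apply: le_trans (normc_sum _) _; apply: ler_sum => k _.
apply: le_trans (le_normcD _ _) _.
rewrite !ComplexField.Normc.normcM !normc_real mulrDr ![eta * _]mulrC.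
have [k1 k2] := h3 k.
by apply: lerD; apply: ler_wpM2l; rewrite ?normc_ge0// ltW.
Qed.

(** One axis [i] carries at least a third of the total size [M] of the
    coefficients, and at one of the two radii on it the field is at least a fixed
    multiple of [M]; by continuity so it is, with half the constant, on a ball
    around that point, inside the shell.  Which ball depends on the
    coefficients, but all six have the same radius. *)
Lemma dipole_shell_coercive (R : realType) (lo hi : R) : 0 < lo -> lo < hi ->
  exists2 c : R, 0 < c & forall al be : 'I_3 -> R[i],
  ((c * (\sum_k (normc (al k) + normc (be k))) ^+ 2)%:E <=
   \int[@lebesgue3 R]_(x in [set x | (lo < Defs.rad x <= hi)%R])
     (normc (\sum_k (al k + (Defs.rad x ^- 3)%:C * be k) * (vec3 x k 0)%:C)
        ^+ 2)%:E)%E.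
Proof.
move=> lo0 lohi.
(* Two distinct radii strictly inside the shell. *)
pose t := (2 * lo + hi) / 3; pose s := (lo + 2 * hi) / 3.
have lot : lo < t by rewrite /t; lra.
have ts : t < s by rewrite /t /s; lra.
have shi : s < hi by rewrite /s; lra.
have [K K0 HK] := two_radii (lt_trans lo0 lot) ts.
pose rho (u : bool) := if u then t else s.
(* By [two_radii] one of the two axis values is at least
   [M / (6 K) = 2 eta M], and a deviation of [eta M] leaves [eta M]. *)
pose eta := (12 * K)^-1.
have eta0 : 0 < eta by rewrite invr_gt0 mulr_gt0.
have [d d0 Hd] : exists2 d : R, 0 < d & forall iu : 'I_3 * bool,
    forall y, ball (axis iu.1 (rho iu.2)) d y ->
    lo < Defs.rad y <= hi /\
    forall al be : 'I_3 -> R[i],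
      normc (al iu.1 * (rho iu.2)%:C + be iu.1 * (rho iu.2 ^- 2)%:C)
        - eta * (\sum_k (normc (al k) + normc (be k)))
      <= normc (\sum_k (al k + (Defs.rad y ^- 3)%:C * be k) * (vec3 y k 0)%:C).
  apply: uniform_pos => [iu c c' _ c'c H y /(le_ball c'c)|[i u]]; first exact: H.
  apply: dipole_field_near_axis => //=; rewrite /rho; case: u => //.
    exact: lt_trans lot ts.
  exact: lt_trans ts shi.
exists (eta ^+ 2 * (d *+ 2) ^+ 3).
  by rewrite mulr_gt0// exprn_gt0// pmulrn_lgt0.
move=> al be; set M := \sum_k _.
have M0 : 0 <= M by apply: sumr_ge0 => k _; rewrite addr_ge0 ?normc_ge0.
have [i Mi] : exists i, M <= 3 * (normc (al i) + normc (be i)).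
  apply: contrapT => /forallNP H; suff : 3 * M < 3 * M by rewrite ltxx.
  have {1}-> : 3 * M = \sum_(k < 3) 3 * (normc (al k) + normc (be k)).
    by rewrite -mulr_sumr.
  have <- : \sum_(k < 3) M = 3 * M by rewrite sumr_const card_ord mulr_natl.
  apply: ltr_sum; first by apply/hasP; exists ord0; rewrite ?mem_index_enum.
  by move=> k _; rewrite ltNge; apply/negP; exact: H.
have [u Mu] : exists u : bool, 2 * eta * M <=
    normc (al i * (rho u)%:C + be i * (rho u ^- 2)%:C).
  have := HK (al i) (be i).
  set X := normc (_ + _ * (t ^- 2)%:C); set Y := normc (_ + _ * (s ^- 2)%:C) => HXY.
  have hM : 4 * (eta * M) <= X + Y.
    rewrite -(ler_pM2l K0); apply: le_trans HXY.
    rewrite (_ : K * (4 * (eta * M)) = M / 3); first by rewrite ler_pdivrMr// mulrC.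
    by rewrite /eta; field; rewrite gt_eqF.
  have [XY|YX] := leP X Y; [exists false|exists true]; rewrite /= -/X -/Y; lra.
have [mQ muQ] := lebesgue3_ball (axis i (rho u)) (ltW d0).
apply: le_trans (@integral_ge_cst_subset _ _ _
  (@lebesgue_measure R \x @lebesgue_measure R \x @lebesgue_measure R)%E
  _ _ _ ((eta * M) ^+ 2) mQ _ (sqr_ge0 _) _ _).
- rewrite [X in (_ <= _ * X)%E]muQ -EFinM lee_fin exprMn; lra.
- by move=> y /(Hd (i, u))[].
- by move=> x _; exact: sqr_ge0.
- move=> y /(Hd (i, u))[_ /(_ al be) /=]; rewrite -/M => h.
  have eM0 : 0 <= eta * M by rewrite mulr_ge0// ltW.
  by rewrite ler_sqr ?nnegrE ?normc_ge0//; lra.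
Qed.

(** The passage to Cartesian coefficients is invertible, as [Y_1^(-1)] and [Y_1^1]
    are independent combinations of the first two coordinates. *)
Lemma cart_bound (R : realType) : exists2 L : R, 0 < L &
  forall (a : 'I_3 -> R[i]) (m : 'I_3),
    normc (a m) <= L * \sum_k normc (cart a k).
Proof.
pose S : R := Num.sqrt (3 / (8 * pi)); pose T : R := Num.sqrt (3 / (4 * pi)).
have S0 : 0 < S by rewrite sqrtr_gt0 divr_gt0// mulr_gt0// pi_gt0.
have T0 : 0 < T by rewrite sqrtr_gt0 divr_gt0// mulr_gt0// pi_gt0.
have S0C : S%:C != 0 :> R[i] by rewrite fmorph_eq0 gt_eqF.
have T0C : T%:C != 0 :> R[i] by rewrite fmorph_eq0 gt_eqF.
have Si : 0 < S^-1 by rewrite invr_gt0.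
have Ti : 0 < T^-1 by rewrite invr_gt0.
exists (S^-1 + T^-1); first exact: addr_gt0.
have sum3 (F : 'I_3 -> R) : \sum_(i < 3) F i = F 0 + F 1 + F 2%:R.
  rewrite !big_ord_recr big_ord0 /= add0r.
  by congr (F _ + F _ + F _); apply/val_inj.
have ni : normc ('i : R[i]) = 1 by rewrite /= expr0n expr1n add0r sqrtr1.
have nI (z : R[i]) : normc ('i * z) = normc z.
  by rewrite ComplexField.Normc.normcM ni mul1r.
have nc (x : R) (z : R[i]) : 0 < x -> normc (x%:C * z) = x * normc z.
  by move=> x0; rewrite ComplexField.Normc.normcM normc_real gtr0_norm.
move=> a m; rewrite sum3.
have := normc_ge0 (cart a 0); have := normc_ge0 (cart a 1).
have := normc_ge0 (cart a 2%:R).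
have c0 : cart a 0 = S%:C * (a 0 - a 2%:R) by [].
have c1 : cart a 1 = - 'i * (S%:C * (a 0 + a 2%:R)) by [].
have c2 : cart a 2%:R = T%:C * a 1 by [].
have e0 : a 0 = (S^-1 / 2)%:C * (cart a 0 + 'i * cart a 1).
  rewrite c0 c1 mulrA mulrN -expr2 sqr_i opprK mul1r.
  by rewrite rmorphM !fmorphV /= rmorph_nat; field.
have e2 : a 2%:R = (S^-1 / 2)%:C * ('i * cart a 1 - cart a 0).
  rewrite c0 c1 mulrA mulrN -expr2 sqr_i opprK mul1r.
  by rewrite rmorphM !fmorphV /= rmorph_nat; field.
have e1 : a 1 = (T^-1)%:C * cart a 2%:R.
  by rewrite c2 fmorphV; field.
have n0 : normc (a 0) <= S^-1 / 2 * (normc (cart a 0) + normc (cart a 1)).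
  rewrite {1}e0 nc ?divr_gt0// ler_pM2l ?divr_gt0//.
  by apply: le_trans (le_normcD _ _) _; rewrite nI.
have n2 : normc (a 2%:R) <= S^-1 / 2 * (normc (cart a 0) + normc (cart a 1)).
  rewrite {1}e2 nc ?divr_gt0// ler_pM2l ?divr_gt0//.
  apply: le_trans (le_normcD _ _) _.
  by rewrite normcN nI addrC.
have n1 : normc (a 1) = T^-1 * normc (cart a 2%:R) by rewrite {1}e1 nc.
have [->|[->|->]] : m = 0 \/ m = 1 \/ m = 2%:R.
- by case: m => -[|[|[|//]]] ?; [left|right;left|right;right]; apply/val_inj.
- move: n0; move: (normc _) (normc _) (normc _) (normc _) => *; nra.
- rewrite n1; move: (normc _) (normc _) (normc _) => *; nra.
- move: n2; move: (normc _) (normc _) (normc _) (normc _) => *; nra.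
Qed.

Lemma shell_potential_coercive (R : realType) (r : nat -> R) (j : nat) :
  0 < r j.-1 -> r j.-1 < r j ->
  exists2 c : R, 0 < c &
  forall (a b : nat -> 'I_3 -> R[i]) (m : 'I_3),
  ((c * (normc (a j m) + normc (b j m)) ^+ 2)%:E <=
   \int[@lebesgue3 R]_(x in shell r j) (normc (potential a b j x) ^+ 2)%:E)%E.
Proof.
move=> r0 rr; have [c c0 Hc] := dipole_shell_coercive r0 rr.
have [L L0 HL] := cart_bound R.
exists (c / L ^+ 2); first by rewrite divr_gt0// exprn_gt0.
move=> a b m; apply: le_trans (_ : _ <= (c * (\sum_k (normc (cart (a j) k)
    + normc (cart (b j) k))) ^+ 2)%:E)%E _; last first.
  apply: le_trans (Hc _ _) _; rewrite le_eqVlt; apply/orP; left; apply/eqP.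
  apply: eq_integral => x /set_mem /=[/andP[rx _]].
  by rewrite potentialE// gt_eqF// (lt_trans r0).
rewrite lee_fin -mulrA ler_pM2l// mulrC ler_pdivrMr ?exprn_gt0// -exprMn.
rewrite ler_sqr ?nnegrE ?addr_ge0 ?normc_ge0//.
  by rewrite big_split/= mulrDl ![_ * L]mulrC; apply: lerD; exact: HL.
apply: mulr_ge0; [apply: sumr_ge0 => k _|exact: ltW].
by rewrite addr_ge0 ?normc_ge0.
Qed.

(** * The Drude permittivity for small damping *)

Lemma drude_lossless (R : realType) (eps0 omegap omega : R) :
  0 < eps0 -> 0 < omegap -> 0 < omega ->
  exists2 C : R, 0 < C & forall tau, 0 < tau ->
    normc (drude eps0 omegap omega tau - drude eps0 omegap omega 0) <= C * tau.
Proof.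
move=> e0 p0 w0; exists (eps0 * omegap ^+ 2 / omega ^+ 3).
  by rewrite divr_gt0 ?mulr_gt0 ?exprn_gt0.
move=> tau tau0; pose z : R[i] := omega +i* tau.
have nz : omega <= normc z.
  rewrite /z /= -[leLHS]gtr0_norm// -sqrtr_sqr ler_sqrt ?addr_ge0 ?sqr_ge0//.
  by rewrite lerDl sqr_ge0.
have nz0 : 0 < normc z by exact: lt_le_trans nz.
have z0 : z != 0.
  by apply: contraTneq nz0 => ->; rewrite ComplexField.Normc.normc0 ltxx.
have zE : z = omega%:C + 'i * tau%:C.
  by apply/eqP; rewrite eq_complex /=; apply/andP; split; apply/eqP; ring.
have w0C : omega%:C != 0 :> R[i] by rewrite fmorph_eq0 gt_eqF.
(* From [1 / omega - 1 / z = i tau / (omega z)] with [z = omega + i tau]; the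
   bound follows since [|z| >= omega]. *)
have -> : drude eps0 omegap omega tau - drude eps0 omegap omega 0 =
    (eps0 * omegap ^+ 2 / omega ^+ 2 * tau)%:C * ('i / z).
  rewrite /drude -/z -[omega +i* 0]/(omega%:C) !rmorphM fmorphV !rmorphXn /=.
  have i0 : 'i != 0 :> R[i] by exact: neq0Ci.
  clearbody z; move: ('i) i0 (omega%:C) w0C (tau%:C) zE (omegap%:C) (eps0%:C)
    => I I0 w w0' t zE p e {nz nz0}; rewrite zE in z0 *.
  by field; rewrite z0 w0'.
rewrite !ComplexField.Normc.normcM normc_real gtr0_norm; last first.
  by rewrite !mulr_gt0 ?invr_gt0 ?exprn_gt0.
have -> : normc ('i : R[i]) = 1 by rewrite /= expr0n expr1n add0r sqrtr1.
rewrite mul1r ComplexField.Normc.normcV ler_pdivrMr//.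
rewrite [leRHS](_ : _ = (eps0 * omegap ^+ 2 / omega ^+ 2 * tau) * (normc z / omega)).
  apply: ler_peMr; last by rewrite ler_pdivlMr// mul1r.
  by rewrite ltW// !mulr_gt0 ?invr_gt0 ?exprn_gt0.
by field; rewrite gt_eqF.
Qed.

Lemma drude_limit (R : realType) (eps0 omegap omega : R) (epsstar : R[i]) :
  0 < eps0 -> 0 < omegap -> 0 < omega ->
  drude eps0 omegap omega tau @[tau --> 0^'+] --> (epsstar : R[i]^o) ->
  epsstar = drude eps0 omegap omega 0.
Proof.
move=> e0 p0 w0 h; have [C C0 HC] := drude_lossless e0 p0 w0.
suff hD : drude eps0 omegap omega tau @[tau --> 0^'+]
    --> (drude eps0 omegap omega 0 : R[i]^o).
  exact: (cvg_unique (@norm_hausdorff R[i] R[i]^o) h hD).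
apply/(@cvgrPdist_le _ R[i]^o) => /= -[e e']; rewrite ltcE/= => /andP[/eqP-> epos].
near=> tau.
have tau0 : 0 < tau by near: tau; exact: nbhs_right_gt.
rewrite distrC -[`|_|]/((normc _)%:C) lecR.
apply: le_trans (HC _ tau0) _.
rewrite mulrC -ler_pdivlMr//; near: tau; apply: nbhs_right_le; exact: divr_gt0.
Unshelve. all: by end_near.
Qed.

(** * Blow-up of the shell coefficients and resonance *)

Lemma layer_pairing_bound (R : realType) (r : nat -> R)
    (a' b' : nat -> 'I_3 -> R[i]) (m : 'I_3) (j : nat) :
  exists2 G : R, 0 < G & forall a b : nat -> 'I_3 -> R[i],
    normc (layer_pairing r a b a' b' m j) <= G * (normc (a j m) + normc (b j m)).
Proof.
pose G1 := normc (a' j m * (r j ^+ 3 - r j.-1 ^+ 3)%:C).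
pose G2 := normc (2 * b' j m * (r j.-1 ^- 3 - r j ^- 3)%:C).
have G10 : 0 <= G1 by exact: normc_ge0.
have G20 : 0 <= G2 by exact: normc_ge0.
exists (G1 + G2 + 1) => [|a b]; first by lra.
have -> : layer_pairing r a b a' b' m j =
    a j m * (a' j m * (r j ^+ 3 - r j.-1 ^+ 3)%:C)
    + b j m * (2 * b' j m * (r j.-1 ^- 3 - r j ^- 3)%:C).
  by rewrite /layer_pairing; ring.
apply: le_trans (le_normcD _ _) _.
rewrite (ComplexField.Normc.normcM (a j m)) (ComplexField.Normc.normcM (b j m)).
rewrite -/G1 -/G2; have := normc_ge0 (a j m); have := normc_ge0 (b j m); nra.
Qed.

(** Evaluating the expansion of the incident field at the unit vectors recovers
    [E0] from its amplitudes. *)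
Lemma incident_neq0 (R : realType) (E0 : 'cV[R[i]]_3) (a0 : 'I_3 -> R[i]) :
  E0 != 0 -> incident E0 a0 -> exists m, a0 m != 0.
Proof.
move=> E00 inc; apply: contrapT => /forallNP H.
move/eqP: E00; apply; apply/matrixP => i k; rewrite ord1 mxE {k}.
have := inc (axis i 1); rewrite big1 ?mulr0; last first.
  by move=> m _; have /negP/negPn/eqP-> := H m; rewrite mul0r.
rewrite /vdot (bigD1 i)//= mxE vec3_axis eqxx mulr1n rmorph1 mulr1.
rewrite big1 ?addr0// => k; rewrite eq_sym => /negbTE ki.
by rewrite mxE vec3_axis ki mulr0n rmorph0 mulr0.
Qed.

(** Reciprocity against the source-free field of a null vector of [P(epsstar)]: the
    fixed incident amplitude times its non-zero dipole moment has to be balanced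
    by the factor [eps - epsstar] times the shell coefficients, which therefore
    blow up as [eps] tends to [epsstar]. *)
Lemma shell_coefficients_blowup (R : realType) (r : nat -> R)
    (eps1 : R) (a0 : 'I_3 -> R[i]) (epsstar : R[i]) (v : 'cV[R[i]]_4)
    (m : 'I_3) :
  0 < r 1%N -> r 1%N < r 2%N -> r 2%N < r 3%N -> r 3%N < r 4%N ->
  0 < eps1 -> epsstar != eps1%:C ->
  Pmx r (permittivity eps1 epsstar) *m v = 0 -> v != 0 -> a0 m != 0 ->
  exists2 k : R, 0 < k & forall (eps : R[i]) (a b : nat -> 'I_3 -> R[i]),
    transmission r (permittivity eps1 eps) a0 a b ->
    k <= normc (eps - epsstar)
         * ((normc (a 2%N m) + normc (b 2%N m))
            + (normc (a 4%N m) + normc (b 4%N m))).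
Proof.
move=> r1 r12 r23 r34 e10 neq Pv v0 a0m.
have r2 := lt_trans r1 r12; have r3 := lt_trans r2 r23.
have r4 := lt_trans r3 r34.
have rpos j : (1 <= j <= 4)%N -> 0 < r j.
  by case: j => [|[|[|[|[|]]]]].
have T := kernel_transmission rpos neq Pv.
have b5 : jump_b r v 5 != 0.
  apply: contra_neq v0 => b5; apply: jump_a_eq0 => j jP.
  by apply: (transmission_unique_continuation r1 r12 r23 r34 (lt0r_neq0 e10) T
    (m := m)).
have [G2 G20 H2] :=
  layer_pairing_bound r (fun j _ => jump_a v j) (fun j _ => jump_b r v j) m 2%N.
have [G4 G40 H4] :=
  layer_pairing_bound r (fun j _ => jump_a v j) (fun j _ => jump_b r v j) m 4%N.
have n0 : 0 < normc (3 * eps1%:C * (a0 m * jump_b r v 5)).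
  rewrite lt0r normc_ge0 andbT; apply/eqP => /ComplexField.Normc.eq0_normc/eqP.
  by rewrite !mulf_eq0 pnatr_eq0 fmorph_eq0 (gt_eqF e10) (negbTE a0m) (negbTE b5).
exists (normc (3 * eps1%:C * (a0 m * jump_b r v 5)) / (G2 + G4)).
  by rewrite divr_gt0// addr_gt0.
move=> eps a b Tab; rewrite ler_pdivrMr ?addr_gt0//.
have := transmission_reciprocity m rpos Tab T.
rewrite mulr0 sub0r mulrN => /(congr1 (fun z => normc (- z))).
rewrite opprK => ->; rewrite -mulNr opprB ComplexField.Normc.normcM -mulrA.
apply: ler_wpM2l; first exact: normc_ge0.
apply: le_trans (le_normcD _ _) _; apply: le_trans (lerD (H2 a b) (H4 a b)) _.
have := normc_ge0 (a 2%N m); have := normc_ge0 (b 2%N m).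
have := normc_ge0 (a 4%N m); have := normc_ge0 (b 4%N m); nra.
Qed.

Theorem theorem4p1 (R : realType) (r : nat -> R)
    (eps0 eps1 omegap omega : R) (epsstar : R[i])
    (E0 : 'cV[R[i]]_3) (a0 : 'I_3 -> R[i]) (a b : R -> nat -> 'I_3 -> R[i]) :
  0 < r 1%N -> r 1%N < r 2%N -> r 2%N < r 3%N -> r 3%N < r 4%N ->
  0 < eps0 -> 0 < eps1 -> 0 < omegap -> 0 < omega ->
  E0 != 0 -> incident E0 a0 ->
  (forall tau : R, 0 < tau ->
    transmission r (permittivity eps1 (drude eps0 omegap omega tau)) a0
      (a tau) (b tau)) ->
  drude eps0 omegap omega tau @[tau --> 0^'+] --> (epsstar : R[i]^o) ->
  epsstar != eps1%:C ->
  (exists v : 'cV[R]_4,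
    [/\ Pmx r (permittivity eps1 epsstar) *m map_mx (real_complex R) v = 0,
        vnorm v = 1
      & vdot v (evec R) != 0]) ->
  plasmon_resonance (fun tau : R => shell_energy r (a tau) (b tau)).
Proof.
move=> r1 r12 r23 r34 e0 e1 p0 w0 E00 inc T lim neq [v [Pv nv _]].
have r3 := lt_trans (lt_trans r1 r12) r23.
have [m a0m] := incident_neq0 E00 inc.
have v0 : map_mx (real_complex R) v != 0.
  apply: contra_eq_neq nv => /eqP; rewrite map_mx_eq0 => /eqP ->.
  by rewrite /vnorm /vdot big1 ?sqrtr0 1?eq_sym ?oner_eq0// => i _; rewrite mxE mul0r.
have [k k0 Hk] := shell_coefficients_blowup r1 r12 r23 r34 e1 neq Pv v0 a0m.
have [C C0 HC] := drude_lossless e0 p0 w0.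
have [c2 c20 H2] := @shell_potential_coercive R r 2%N r1 r12.
have [c4 c40 H4] := @shell_potential_coercive R r 4%N r3 r34.
pose c := Num.min c2 c4 / 2 * (k / C) ^+ 2.
have c0 : 0 < c.
  by rewrite !mulr_gt0// ?exprn_gt0 ?divr_gt0// ?invr_gt0// lt_min c20.
have energy_lower tau : 0 < tau ->
    ((c / tau)%:E <= tau%:E * shell_energy r (a tau) (b tau))%E.
  move=> tau0; rewrite -lee_pdivrMl//.
  apply: le_trans (leeD (H2 (a tau) (b tau) m) (H4 (a tau) (b tau) m)).
  have := Hk _ _ _ (T tau tau0); rewrite (drude_limit e0 p0 w0 lim) => {}Hk.
  set x := normc _ + normc _ in Hk *; set y := normc _ + normc _ in Hk *.
  have x0 : 0 <= x by rewrite addr_ge0 ?normc_ge0.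
  have y0 : 0 <= y by rewrite addr_ge0 ?normc_ge0.
  have kxy : k / C / tau <= x + y.
    rewrite !ler_pdivrMr//; apply: le_trans Hk _.
    by rewrite mulrC -mulrA (mulrC tau); apply: ler_wpM2l; [exact: addr_ge0|exact: HC].
  rewrite -EFinM -EFinD lee_fin.
  have -> : tau^-1 * (c / tau) = Num.min c2 c4 / 2 * (k / C / tau) ^+ 2.
    by rewrite /c; field; rewrite !gt_eqF.
  have kt : 0 <= k / C / tau by rewrite !divr_ge0// ltW.
  have h2 : Num.min c2 c4 <= c2 by rewrite ge_min lexx.
  have h4 : Num.min c2 c4 <= c4 by rewrite ge_min lexx orbT.
  have h0 : 0 < Num.min c2 c4 by rewrite lt_min c20.
  apply: le_trans (_ : Num.min c2 c4 * (x ^+ 2 + y ^+ 2) <= _); last first.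
    by rewrite mulrDr; apply: lerD; apply: ler_wpM2r => //; exact: sqr_ge0.
  rewrite -mulrA ler_pM2l//.
  have := sqr_ge0 (x - y); move: (k / C / tau) kt kxy => s s0 sxy; nra.
apply/cvgeyPge => A; near=> tau.
have tau0 : 0 < tau by near: tau; exact: nbhs_right_gt.
apply: le_trans (energy_lower tau tau0); rewrite lee_fin.
have A0 : 0 < `|A| + 1 by rewrite ltr_wpDl.
apply: (@le_trans _ _ (`|A| + 1)); first by rewrite (le_trans (ler_norm A))// lerDl.
rewrite ler_pdivlMr// mulrC -ler_pdivlMr//.
near: tau; apply: nbhs_right_le; exact: divr_gt0.
Unshelve. all: by end_near.
Qed.
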